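(* (1) Let $g_1,g_2\in L^2(\nu)$. Then for every $n\in\{0,1,2,\dots\}$ $$\langle g_1\circ X_n,\ P(g_2)\circ X_n-g_2\circ X_{n+1}\rangle_{Diss}=0 .$$ (2) For any $f\in L^2(\nu)$ and any $n\in\mathbb N$, the functions $(I-P)(f)\circ X_n$ and $P(f)\circ X_n-f\circ X_{n+1}$ are orthogonal in the dissipation space $Diss$.
   Context: Setting. $(V,\mathcal B)$ is an uncountable standard Borel space, $\mu$ a non-atomic $\sigma$-finite positive Borel measure on it. $\rho$ is a $\sigma$-finite positive measure on $(V\times V,\mathcal B\times\mathcal B)$ which is symmetric, $\rho(A\times B)=\rho(B\times A)$ for all $A,B\in\mathcal B$, and which disintegrates as $\rho(f)=\int_V\int_V f(x,y)\,d\rho_x(y)\,d\mu(x)$ for a measurable field of measures $x\mapsto\rho_x$. The function $c(x):=\rho_x(V)$ satisfies $0<c(x)<\infty$ for $\mu$-a.e. $x$ and $\int_A c\,d\mu<\infty$ whenever $\mu(A)<\infty$. Put $d\nu=c\,d\mu$, $P(x,dy)=c(x)^{-1}d\rho_x(y)$ and $P(f)(x)=\int_V f(y)\,P(x,dy)$ (the Markov operator). Path space. $\Omega=V^{\{0,1,2,\dots\}}$ with the $\sigma$-algebra $\mathcal C$ generated by cylinder sets, $X_n(\omega)=\omega_n$, $\Omega_x=\{\omega:X_0(\omega)=x\}$, and $\mathbb P_x$ is the probability measure on $\Omega_x$ (Kolmogorov extension) with $$\mathbb P_x(X_1\in A_1,\dots,X_n\in A_n)=\int_{A_1}\cdots\int_{A_{n-1}}P(y_{n-1},A_n)P(y_{n-2},dy_{n-1})\cdots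 P(x,dy_1).$$ Put $\lambda=\int_V\mathbb P_x\,d\nu(x)$ on $(\Omega,\mathcal C)$. The dissipation space $Diss$ is $L^2(\Omega,\mathcal C,\lambda)$ with the rescaled inner product $\langle f,g\rangle_{Diss}=\frac12\int_\Omega fg\,d\lambda=\frac12\int_V\int_{\Omega_x}f g\,d\mathbb P_x\,d\nu(x)$. *)

(* Defs.v *)
From HB Require Import structures.
From mathcomp Require Import all_boot all_order all_algebra.
From mathcomp Require Import all_classical all_reals all_analysis.
From mathcomp Require Import measurable_realfun.

Set Implicit Arguments.
Unset Strict Implicit.
Unset Printing Implicit Defensive.

Import Order.TTheory GRing.Theory Num.Theory.
Import numFieldNormedType.Exports.

Local Open Scope classical_set_scope.
Local Open Scope ring_scope.

Definition polish (R : realType) (X : metricType R) : Prop :=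
  (forall F : set_system X, ProperFilter F -> cauchy F -> exists x : X, F --> x) /\
  (exists2 D : set X, countable D & dense D).

(* Borel-isomorphic to a Polish space equipped with its Borel sigma-algebra *)
Definition standard_borel (R : realType) d (V : measurableType d) : Prop :=
  exists (X : metricType R) (f : V -> X),
    [/\ polish X, bijective f &
        (measurable : set (set V)) =
        preimage_set_system setT f <<s (open : set (set X)) >>].

Definition non_atomic d (V : measurableType d) (R : realType)
    (mu : {measure set V -> \bar R}) : Prop :=
  forall A, measurable A -> (0 < mu A)%E ->
    exists B, [/\ measurable B, B `<=` A & (0 < mu B < mu A)%E].

Section integrated_kernel.
Context d d' (X : measurableType d) (Y : measurableType d') (R : realType).
Variables (mu : {measure set X -> \bar R}) (k : R.-ker X ~> Y).
Local Open Scope ereal_scope.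

(* The measure \int_X k_x dmu(x) on Y *)
Definition kmix (C : set Y) : \bar R := \int[mu]_x k x C.

Let kmix0 : kmix set0 = 0.
Proof.
by rewrite /kmix (eq_integral (cst 0)) ?integral0// => x _; rewrite measure0.
Qed.

Let kmix_ge0 C : 0 <= kmix C. Proof. exact: integral_ge0. Qed.

Let kmix_sigma_additive : semi_sigma_additive kmix.
Proof.
move=> U mU tU mUU; rewrite [X in _ --> X](_ : _ =
  \int[mu]_x (\sum_(n <oo) k x (U n))); last first.
  apply: eq_integral => x _.
  by apply/esym/cvg_lim => //; exact/measure_semi_sigma_additive.
apply/cvg_closeP; split.
  by apply: is_cvg_nneseries => n _ _; exact: integral_ge0.
rewrite closeE// integral_nneseries// => n.
exact: measurable_kernel.
Qed.

HB.instance Definition _ := isMeasure.Build _ _ R kmix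
  kmix0 kmix_ge0 kmix_sigma_additive.

End integrated_kernel.

Section weighted_measure.
Context d d' (X : measurableType d) (Y : measurableType d') (R : realType).
Variables (mu : {measure set X -> \bar R}) (k : R.-ker X ~> Y).
Local Open Scope ereal_scope.

Definition ktotal (x : X) : \bar R := k x setT.

(* The measure with density ktotal with respect to mu *)
Definition kweight (A : set X) : \bar R := \int[mu]_(x in A) ktotal x.

Let kweight0 : kweight set0 = 0.
Proof. exact: integral_set0. Qed.

Let kweight_ge0 A : 0 <= kweight A. Proof. exact: integral_ge0. Qed.

Let kweight_sigma_additive : semi_sigma_additive kweight.
Proof.
move=> U mU tU mUU; rewrite /kweight ge0_integral_bigcup//.
  by apply: is_cvg_nneseries => n _ _; exact: integral_ge0.
by apply: (measurable_funS measurableT) => //; exact: measurable_kernel.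
Qed.

HB.instance Definition _ := isMeasure.Build _ _ R kweight
  kweight0 kweight_ge0 kweight_sigma_additive.

End weighted_measure.

Section markov.
Context d (V : measurableType d) (R : realType).
Variable rho_ : R.-ker V ~> V.

Let ktotalV_ge0 x : 0 <= (fine (ktotal rho_ x))^-1.
Proof. by rewrite invr_ge0 fine_ge0. Qed.

(* P(x, dy) = c(x)^-1 rho_x(dy); by the conventions 0^-1 = 0 and fine +oo = 0
   this is the zero measure when c(x) is 0 or +oo. *)
Definition transition (x : V) : {measure set V -> \bar R} :=
  mscale (NngNum (ktotalV_ge0 x)) (rho_ x).

Definition markov_op (f : V -> R) (x : V) : R :=
  \int[transition x]_y f y.

End markov.

Section path_space.
Context d (V : measurableType d) (R : realType).

Definition cylinders : set (set (nat -> V)) :=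
  [set C | exists (n : nat) (A : nat -> set V),
     (forall i, measurable (A i)) /\
     C = [set w | forall i, (i <= n)%N -> A i (w i)]].

Definition path_space := g_sigma_algebraType cylinders.

Definition path_coord (n : nat) (w : path_space) : V := w n.

Definition paths_from (x : V) : set path_space := [set w | path_coord 0 w = x].

Variable rho_ : R.-ker V ~> V.

(* \int_{A 1} P(x, dy_1) \int_{A 2} P(y_1, dy_2) ... \int_{A n} P(y_(n-1), dy_n);
   the innermost integral is P(y_(n-1), A n). *)
Fixpoint path_weight (n : nat) (A : nat -> set V) (x : V) : \bar R :=
  if n is m.+1 then
    (\int[transition rho_ x]_(y in A 1%N) path_weight m (fun i => A i.+1) y)%E
  else 1%E.

(* Q is the law of the Markov chain started at x: it is carried by the paths
   issued from x and has the prescribed finite-dimensional distributions,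
   which determine it on the sigma-algebra generated by the cylinders. *)
Definition markov_path_law (x : V) (Q : set path_space -> \bar R) : Prop :=
  Q (paths_from x) = 1%E /\
  forall (n : nat) (A : nat -> set V), (forall i, measurable (A i)) ->
    Q [set w | forall i, (1 <= i <= n)%N -> A i (path_coord i w)] =
    path_weight n A x.

End path_space.

Section dissipation_space.
Context d (Omega : measurableType d) (R : realType).
Variable lambda : {measure set Omega -> \bar R}.

(* Elements of Diss = L^2(lambda) are handled through representatives;
   membership is recorded because the integral below is 0 by convention when it
   is not defined. *)
Definition in_diss (f : Omega -> R) : Prop := f \in Lfun lambda 2%:E.

Definition diss_inner (f g : Omega -> R) : R :=
  2^-1 * \int[lambda]_w (f w * g w).

Definition diss_orthogonal (f g : Omega -> R) : Prop :=
  [/\ in_diss f, in_diss g & diss_inner f g = 0].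

End dissipation_space.

(* Main.v *)
(** Under [lambda] the pair [(X_n, X_(n+1))] has law [rho], for every [n]: the
    marginals of [rho] are both [nu] by symmetry, so [nu] is stationary for [P],
    and the Markov property gives the law of the pair on rectangles.  Hence all
    the inner products are integrals against [rho], and the orthogonality
    reads
      [\int g(x) (P f)(x) drho(x, y) = \int g(x) f(y) drho(x, y)],
    which is the disintegration of [rho] along its first coordinate. *)

Require Import Defs.
From HB Require Import structures.
From mathcomp Require Import all_boot all_order all_algebra.
From mathcomp Require Import all_classical all_reals all_analysis.
From mathcomp Require Import measurable_realfun.
From mathcomp Require Import ring.

Set Implicit Arguments.
Unset Strict Implicit.
Unset Printing Implicit Defensive.

Import Order.TTheory GRing.Theory Num.Theory.
Import numFieldNormedType.Exports.

Local Open Scope classical_set_scope.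
Local Open Scope ring_scope.

(** * Measurability of points and of path coordinates *)

(** Points of a metric space are closed, and the injectivity of [f] makes [[set x]] the preimage of
    [[set f x]]. This serves to make [paths_from x] an event. *)
Lemma standard_borel_measurable_set1 (R : realType) d (V : measurableType d)
  (x : V) : standard_borel R V -> measurable [set x].
Proof.
move=> [X [f [_ fbij mE]]]; rewrite mE.
exists [set f x].
  rewrite -[[set f x]]setCK -setTD; apply: sigma_algebraCD.
  apply: sub_sigma_algebra.
  rewrite openC; apply: accessible_closed_set1; apply: hausdorff_accessible.
  exact: metric_hausdorff.
by apply/seteqP; split => y /= => [[_ /(bij_inj fbij)]|->].
Qed.

Lemma measurable_path_coord d (V : measurableType d) (n : nat) :
  measurable_fun [set: path_space V] (path_coord n).
Proof.
move=> _ A mA; apply: sub_sigma_algebra.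
exists n, (fun i => if i == n then A else setT); split.
  by move=> i; case: ifP.
apply/seteqP; split => w /= => [[_ wA] i _|wA].
  by case: eqP => // ->.
by split => //; have := wA n (leqnn n); rewrite eqxx.
Qed.

(** * Square-integrable functions *)

Section Lfun2.
Context d (T : measurableType d) (R : realType).
Implicit Types (m : {measure set T -> \bar R}) (f g : T -> R).

Lemma Lfun2P m f : f \in Lfun m 2%:E <->
  measurable_fun setT f /\ (\int[m]_x (f x ^+ 2)%:E < +oo)%E.
Proof.
have normE x : ((`|(f x)%:E| `^ 2)%E = (f x ^+ 2)%:E)%E.
  by rewrite poweR_EFin powR_mulrn// real_normK// num_real.
split=> [f2|[mf fin]].
  have /integrable_lty := Lfun2_integrable_sqr f2; move=> /(_ measurableT) ?.
  by split => //; move: f2; rewrite inE => /andP[/[!inE]].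
rewrite inE; apply/andP; split; rewrite inE//=.
rewrite /finite_norm unlock poweR_lty//.
by under eq_integral do rewrite normE.
Qed.

Lemma measurable_Lfun2 m f : f \in Lfun m 2%:E -> measurable_fun setT f.
Proof. by case/Lfun2P. Qed.

Lemma Lfun2_le m f g : g \in Lfun m 2%:E -> measurable_fun setT f ->
  (forall x, `|f x| <= `|g x|) -> f \in Lfun m 2%:E.
Proof.
move=> /Lfun2P[mg goo] mf fg; apply/Lfun2P; split => //.
apply: le_lt_trans goo; apply: ge0_le_integral => //.
- by move=> x _; rewrite lee_fin sqr_ge0.
- by apply/measurable_EFinP; exact: measurable_funX.
- by apply/measurable_EFinP; exact: measurable_funX.
- move=> x _; rewrite lee_fin -(@real_normK _ (f x)) ?num_real//.
  by rewrite -(@real_normK _ (g x)) ?num_real// lerXn2r ?nnegrE.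
Qed.

Lemma Lfun2_funrpos m f : f \in Lfun m 2%:E -> f^\+ \in Lfun m 2%:E.
Proof.
move=> f2; apply: (Lfun2_le f2).
  exact/measurable_funrpos/(measurable_Lfun2 f2).
move=> x; rewrite -[leRHS]/((Num.norm \o f) x) -funrposDneg ger0_norm//.
by rewrite lerDl.
Qed.

Lemma Lfun2_funrneg m f : f \in Lfun m 2%:E -> f^\- \in Lfun m 2%:E.
Proof.
move=> f2; apply: (Lfun2_le f2).
  exact/measurable_funrneg/(measurable_Lfun2 f2).
move=> x; rewrite -[leRHS]/((Num.norm \o f) x) -funrposDneg ger0_norm//.
by rewrite lerDr.
Qed.

Lemma Lfun2B m f g : f \in Lfun m 2%:E -> g \in Lfun m 2%:E ->
  (fun x => f x - g x) \in Lfun m 2%:E.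
Proof.
move=> f2 g2; rewrite -[X in X \in _]/(f - g).
by apply: rpredB => //; rewrite lee1n.
Qed.

Lemma Lfun2_integrableM m f g : f \in Lfun m 2%:E -> g \in Lfun m 2%:E ->
  m.-integrable setT (EFin \o (fun x => f x * g x)).
Proof. by move=> f2 g2; apply/Lfun1_integrable/Lfun2_mul_Lfun1. Qed.

(** Jensen's inequality for the square, obtained by integrating $(f-a)^2\ge 0$ with $a=\int f\,dm$.
    Mass at most 1, rather than exactly 1, is assumed because [transition] may be the zero measure
    at some points. *)
Lemma Rintegral_sqr_le m f : (m setT <= 1)%E -> measurable_fun setT f ->
  (((\int[m]_x f x) ^+ 2)%:E <= \int[m]_x (f x ^+ 2)%:E)%E.
Proof.
move=> m1 mf.
have mfin : m setT \is a fin_num.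
  by rewrite ge0_fin_numE// (le_lt_trans m1)// ltry.
(* An infinite right-hand side leaves nothing to prove; otherwise [f] is in $L^2$, hence in $L^1$
   since [m] is finite. *)
have [|foo] := leP +oo%E (\int[m]_x (f x ^+ 2)%:E)%E.
  by rewrite leye_eq => /eqP ->; rewrite leey.
have f2 : f \in Lfun m 2%:E by exact/Lfun2P.
have if2 := Lfun2_integrable_sqr f2.
have /Lfun1_integrable if1 := Lfun_subset12 mfin f2.
rewrite -(@fineK _ (\int[m]_x (f x ^+ 2)%:E)%E); last exact: integrable_fin_num.
rewrite lee_fin -[leRHS]/(\int[m]_x (f x ^+ 2)).
set a := \int[m]_x f x; set b := \int[m]_x _.
have ia (c : R) : m.-integrable setT (EFin \o cst c).
  apply/integrableP; split; first exact/measurable_EFinP.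
  have /= -> := integral_cst m measurableT `|c|%:E.
  by rewrite lte_mul_pinfty// -ge0_fin_numE.
have i2a : m.-integrable setT (EFin \o (fun x => a *+ 2 * f x)).
  exact: (integrableZl measurableT _ if1).
have : 0 <= \int[m]_x (f x ^+ 2 - (a *+ 2 * f x - a ^+ 2)).
  apply: Rintegral_ge0 => x _.
  rewrite (_ : _ - _ = (f x - a) ^+ 2) ?sqr_ge0//; ring.
rewrite RintegralB//; last exact: (integrableB measurableT i2a (ia _)).
rewrite RintegralB//; last exact: ia.
rewrite RintegralZl// Rintegral_cst// -/a -/b.
have M1 : fine (m setT) <= 1 by rewrite -lee_fin fineK.
(* With $M=m(T)$ the integrated square gives $2a^2-a^2M\le b$, and $M\le 1$ bounds the left side
   below by $a^2$. *)
rewrite subr_ge0 => /(le_trans _); apply.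
rewrite lerBrDr (_ : a *+ 2 * a = a ^+ 2 + a ^+ 2); last ring.
by rewrite lerD2l ler_piMr// sqr_ge0.
Qed.
End Lfun2.

(** * Transfer along a map carrying one measure to another *)

Section image_measure.
Context d1 d2 (X : measurableType d1) (Y : measurableType d2) (R : realType).
Variables (phi : X -> Y) (mphi : measurable_fun setT phi).
Variables (m1 : {measure set X -> \bar R}) (m2 : {measure set Y -> \bar R}).
Hypothesis m12 : forall A, measurable A -> m1 (phi @^-1` A) = m2 A.

(** By [m12], [m2] is the image of [m1] under [phi]. The lemmas here are applied to both
    projections, which carry [rho] to [nu], and to the pair of consecutive coordinates, which
    carries [lambda] to [rho]. *)
Lemma ge0_integral_image (f : Y -> \bar R) : measurable_fun setT f ->
  (forall y, 0 <= f y)%E -> (\int[m1]_x f (phi x) = \int[m2]_y f y)%E.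
Proof.
move=> mf f0.
rewrite (@eq_measure_integral _ _ _ _ (pushforward m1 phi)) => [|A mA _].
  by rewrite [RHS]ge0_integral_pushforward.
by rewrite -m12.
Qed.

Lemma Rintegral_image (f : Y -> R) : m2.-integrable setT (EFin \o f) ->
  \int[m1]_x f (phi x) = \int[m2]_y f y.
Proof.
move=> /integrableP[mf foo]; congr fine.
rewrite [RHS](@eq_measure_integral _ _ _ _ (pushforward m1 phi)) => [|A mA _].
  rewrite [RHS]integral_pushforward//; apply/integrableP; split.
    exact: measurableT_comp.
  rewrite (ge0_integral_image (f := fun y => `|(f y)%:E|%E))//.
  exact: measurableT_comp.
by rewrite -m12.
Qed.

Lemma ae_image (P : Y -> Prop) :
  {ae m2, forall y, P y} -> {ae m1, forall x, P (phi x)}.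
Proof.
move=> [N [mN N0 PN]]; exists (phi @^-1` N); split.
- by rewrite -[X in measurable X]setTI; exact: mphi.
- by rewrite m12.
- by move=> x /PN.
Qed.

Lemma Lfun2_image (f : Y -> R) :
  f \in Lfun m2 2%:E -> f \o phi \in Lfun m1 2%:E.
Proof.
move=> /Lfun2P[mf foo]; apply/Lfun2P; split; first exact: measurableT_comp.
rewrite (ge0_integral_image (f := fun y => (f y ^+ 2)%:E))//.
  by apply/measurable_EFinP; exact: measurable_funX.
by move=> y; rewrite lee_fin sqr_ge0.
Qed.

End image_measure.

(** * The transition kernel and the Markov operator *)

Section transition_kernel.
Context d (V : measurableType d) (R : realType) (rho_ : R.-ker V ~> V).
Local Open Scope ereal_scope.
Local Notation T f := (fun x => \int[transition rho_ x]_y f y).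

Lemma measurable_transition A : measurable A ->
  measurable_fun setT (fun x => transition rho_ x A).
Proof.
move=> mA; rewrite /transition /= /mscale /=.
apply: emeasurable_funM; last exact: measurable_kernel.
apply/measurable_EFinP.
(* On non-negative reals the inverse is the power $-1$, also at 0 by the convention for [0^-1];
   powers are measurable. *)
under eq_fun do rewrite -powR_inv1 ?fine_ge0//.
apply: (measurableT_comp (measurable_powR _)).
apply: measurableT_comp => //; exact: measurable_kernel.
Qed.

Lemma measurable_transition_integral (f : V -> \bar R) :
  measurable_fun setT f -> (forall y, 0 <= f y) -> measurable_fun setT (T f).
Proof.
move=> mf f0; apply: measurable_fun_integral_kernel => // A mA.
exact: measurable_transition.
Qed.

Lemma transition_integral_ge0 (f : V -> \bar R) x :
  (forall y, 0 <= f y) -> 0 <= T f x.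
Proof. by move=> f0; exact: integral_ge0. Qed.

(** The mass is 1 where $0<c(x)<\infty$ and 0 elsewhere, so the bound holds at every point and not
    just almost everywhere. *)
Lemma transition_setT_le1 x : transition rho_ x setT <= 1.
Proof.
rewrite /transition /= /mscale /= /ktotal.
have : 0 <= rho_ x setT by [].
case: (rho_ x setT) => [r r0|_|//] /=.
  rewrite -EFinM lee_fin.
  have [->|rn0] := eqVneq r 0%R; first by rewrite mulr0.
  by rewrite mulVf.
by rewrite invr0 mul0e.
Qed.

Lemma ktotal_transition_integral (f : V -> \bar R) x :
  0 < ktotal rho_ x < +oo -> measurable_fun setT f -> (forall y, 0 <= f y) ->
  T f x * ktotal rho_ x = \int[rho_ x]_y f y.
Proof.
move=> /andP[c0 coo] mf f0; rewrite ge0_integral_mscale//=.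
rewrite muleC muleA -[X in X * _ * _]fineK; last by rewrite ge0_fin_numE// ltW.
rewrite -EFinM mulfV ?mul1e//.
by rewrite gt_eqF// fine_gt0// c0.
Qed.

Lemma measurable_markov_op (f : V -> R) :
  measurable_fun setT f -> measurable_fun setT (markov_op rho_ f).
Proof.
move=> mf; apply: measurableT_comp => //.
under eq_fun do rewrite integralE.
apply: emeasurable_funB; apply: measurable_transition_integral => //.
  exact/measurable_funepos/measurable_EFinP.
exact/measurable_funeneg/measurable_EFinP.
Qed.

Lemma markov_op_sqr_le (f : V -> R) x : measurable_fun setT f ->
  (markov_op rho_ f x ^+ 2)%:E <= \int[transition rho_ x]_y (f y ^+ 2)%:E.
Proof. by move=> mf; exact/Rintegral_sqr_le/mf/transition_setT_le1. Qed.

End transition_kernel.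

(** * Stationarity of [nu] and orthogonality with respect to [rho] *)

Section stationary_chain.
Context d (V : measurableType d) (R : realType).
Variable mu : {measure set V -> \bar R}.
Variable rho : {measure set (V * V) -> \bar R}.
Variable rho_ : R.-ker V ~> V.
Hypothesis rho_sym : forall A B : set V, measurable A -> measurable B ->
  rho (A `*` B) = rho (B `*` A).
Hypothesis rho_disintegration : forall f : V * V -> \bar R,
  measurable_fun setT f -> (forall z, (0 <= f z)%E) ->
  (\int[rho]_z f z = \int[mu]_x \int[rho_ x]_y f (x, y))%E.
Hypothesis c_pos_fin : {ae mu, forall x, (0 < ktotal rho_ x < +oo)%E}.

Local Notation nu := (kweight mu rho_ : {measure set V -> \bar R}).
Local Notation T f := (fun x => \int[transition rho_ x]_y f y)%E.

Lemma rho_fst A : measurable A -> rho (fst @^-1` A) = nu A.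
Proof.
move=> mA; rewrite -[in LHS](setIT (fst @^-1` A)) -integral_indic//; last first.
  by rewrite -[X in measurable X]setTI; exact: measurable_fst.
rewrite rho_disintegration//; last first.
  apply/measurable_EFinP; apply: measurable_indic.
  by rewrite -[X in measurable X]setTI; exact: measurable_fst.
rewrite /= /kweight [RHS]integral_mkcond; apply: eq_integral => x _.
rewrite patchE; have [xA|xA] := boolP (x \in A).
  rewrite (eq_integral (cst 1%E)) ?integral_cst ?mul1e// => y _.
  by rewrite indicE mem_set//; move: xA; rewrite inE.
rewrite (eq_integral (cst 0%E)) ?integral0// => y _.
by rewrite indicE memNset//= => Ax; move: xA; rewrite notin_setE.
Qed.

(** Here the symmetry of [rho] enters: it exchanges $V\times A$ and $A\times V$, so both marginals
    are [nu]. *)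
Lemma rho_snd A : measurable A -> rho (snd @^-1` A) = nu A.
Proof.
move=> mA; rewrite -rho_fst//.
rewrite (_ : snd @^-1` A = setT `*` A); last by apply/seteqP; split => z // -[].
rewrite (_ : fst @^-1` A = A `*` setT); last by apply/seteqP; split => z // -[].
exact: rho_sym.
Qed.

(** After disintegration the left integrand is constant in $y$; integrating it produces the factor
    $c(x)$, which cancels the normalisation of $P(x,dy)$. Both sides become $\int g(x)\int
    f\,d\rho_x\,d\mu(x)$. Extended values of [f] avoid any finiteness condition. *)
Lemma integral_rho_transition (g : V -> R) (f : V -> \bar R) :
  measurable_fun setT g -> (forall x, 0 <= g x) ->
  measurable_fun setT f -> (forall y, 0 <= f y)%E ->
  (\int[rho]_z ((g z.1)%:E * T f z.1) = \int[rho]_z ((g z.1)%:E * f z.2))%E.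
Proof.
move=> mg g0 mf f0.
have mgE : measurable_fun setT (EFin \o g) by exact/measurable_EFinP.
have mT := measurable_transition_integral rho_ mf f0.
have mg1 : measurable_fun setT (fun z : V * V => (g z.1)%:E).
  exact: (measurableT_comp mgE measurable_fst).
rewrite rho_disintegration; last 2 first.
- apply: (emeasurable_funM mg1); exact: (measurableT_comp mT measurable_fst).
- by move=> z; rewrite mule_ge0 ?lee_fin// transition_integral_ge0.
rewrite rho_disintegration; last 2 first.
- apply: (emeasurable_funM mg1); exact: (measurableT_comp mf measurable_snd).
- by move=> z; rewrite mule_ge0 ?lee_fin.
rewrite (eq_integral (fun x => (g x)%:E * (T f x * ktotal rho_ x))%E); last first.
  by move=> x _ /=; rewrite muleA -(integral_cst (rho_ x) measurableT).
rewrite [RHS](eq_integral (fun x => (g x)%:E * \int[rho_ x]_y f y)%E); last first.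
  by move=> x _ /=; rewrite ge0_integralZl// lee_fin.
have mk : measurable_fun setT (ktotal rho_) by exact: measurable_kernel.
apply: ge0_ae_eq_integral => //.
- by do 2 apply: emeasurable_funM => //.
- apply: emeasurable_funM => //.
  by apply: measurable_fun_integral_kernel => // A mA; exact: measurable_kernel.
- by move=> x _; rewrite !mule_ge0 ?lee_fin// transition_integral_ge0.
- by move=> x _; rewrite mule_ge0 ?lee_fin// integral_ge0.
- apply: filterS c_pos_fin => x cx _ /=.
  by rewrite ktotal_transition_integral.
Qed.

Lemma integral_nu_fst (f : V -> \bar R) :
  measurable_fun setT f -> (forall y, 0 <= f y)%E ->
  (\int[rho]_z f z.1 = \int[nu]_x f x)%E.
Proof.
exact: (ge0_integral_image measurable_fst rho_fst).
Qed.

Lemma integral_nu_snd (f : V -> \bar R) :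
  measurable_fun setT f -> (forall y, 0 <= f y)%E ->
  (\int[rho]_z f z.2 = \int[nu]_x f x)%E.
Proof.
exact: (ge0_integral_image measurable_snd rho_snd).
Qed.

(** With $g=1$ in the previous identity, $\int Tf\,d\nu=\int Tf(x)\,d\rho=\int f(y)\,d\rho=\int
    f\,d\nu$, by the first and the second marginal of [rho]. *)
Lemma transition_stationary (f : V -> \bar R) :
  measurable_fun setT f -> (forall y, 0 <= f y)%E ->
  (\int[nu]_x T f x = \int[nu]_x f x)%E.
Proof.
move=> mf f0; rewrite -[RHS]integral_nu_snd// -integral_nu_fst; last 2 first.
- exact: measurable_transition_integral.
- by move=> x; exact: transition_integral_ge0.
have := integral_rho_transition (g := cst 1) (measurable_cst _) (fun=> ler01) mf.
move=> /(_ f0); under eq_integral do rewrite mul1e.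
by under [in RHS]eq_integral do rewrite mul1e.
Qed.

(** Pointwise $(Pf)^2\le T(f^2)$ by Jensen, and stationarity gives $\int T(f^2)\,d\nu=\int
    f^2\,d\nu$. *)
Lemma markov_op_Lfun2 (f : V -> R) :
  f \in Lfun nu 2%:E -> markov_op rho_ f \in Lfun nu 2%:E.
Proof.
move=> /Lfun2P[mf foo]; have mPf := measurable_markov_op rho_ mf.
have mf2 : measurable_fun setT (fun y => (f y ^+ 2)%:E).
  by apply/measurable_EFinP; exact: measurable_funX.
apply/Lfun2P; split => //; apply: le_lt_trans foo.
rewrite -[leRHS]transition_stationary// => [|y]; last first.
  by rewrite lee_fin sqr_ge0.
apply: ge0_le_integral => //.
- by move=> x _; rewrite lee_fin sqr_ge0.
- by apply/measurable_EFinP; exact: measurable_funX.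
- by apply: measurable_transition_integral => // y; rewrite lee_fin sqr_ge0.
- by move=> x _; exact: markov_op_sqr_le.
Qed.

Lemma Lfun2_rho_fst (f : V -> R) :
  f \in Lfun nu 2%:E -> (fun z => f z.1) \in Lfun rho 2%:E.
Proof. exact: (Lfun2_image measurable_fst rho_fst). Qed.

Lemma Lfun2_rho_snd (f : V -> R) :
  f \in Lfun nu 2%:E -> (fun z => f z.2) \in Lfun rho 2%:E.
Proof. exact: (Lfun2_image measurable_snd rho_snd). Qed.

(** By stationarity $T(f^2)$ has finite [nu]-integral, hence is finite almost everywhere. *)
Lemma ae_transition_Lfun2 (f : V -> R) : f \in Lfun nu 2%:E ->
  {ae nu, forall x, f \in Lfun (transition rho_ x) 2%:E}.
Proof.
move=> /Lfun2P[mf foo].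
have mf2 : measurable_fun setT (fun y => (f y ^+ 2)%:E).
  by apply/measurable_EFinP; exact: measurable_funX.
have f20 y : (0 <= (f y ^+ 2)%:E)%E by rewrite lee_fin sqr_ge0.
have iT : nu.-integrable setT (T (fun y => (f y ^+ 2)%:E)).
  apply/integrableP; split; first exact: measurable_transition_integral.
  under eq_integral do rewrite gee0_abs ?transition_integral_ge0//.
  by rewrite transition_stationary.
have := integrable_ae measurableT iT; apply: filterS => x /(_ Logic.I) Tfin.
by apply/Lfun2P; split => //; rewrite -ge0_fin_numE// integral_ge0.
Qed.

(** [markov_op] takes [fine] of an integral, which is 0 at infinite values; it is additive and
    agrees with the extended integral only where [f] is integrable. *)
Lemma ae_transition_integrable (f : V -> R) : f \in Lfun nu 2%:E ->
  {ae nu, forall x, (transition rho_ x).-integrable setT (EFin \o f)}.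
Proof.
move=> /ae_transition_Lfun2; apply: filterS => x fx.
apply/Lfun1_integrable; apply: Lfun_subset12 fx.
by rewrite ge0_fin_numE// (le_lt_trans (transition_setT_le1 _ _))// ltry.
Qed.

Lemma ge0_markov_op_adjoint (g f : V -> R) :
  g \in Lfun nu 2%:E -> f \in Lfun nu 2%:E ->
  (forall x, 0 <= g x) -> (forall x, 0 <= f x) ->
  \int[rho]_z (g z.1 * markov_op rho_ f z.1) = \int[rho]_z (g z.1 * f z.2).
Proof.
move=> g2 f2 g0 f0; congr fine.
have mg := measurable_Lfun2 g2; have mf := measurable_Lfun2 f2.
have mfE : measurable_fun setT (EFin \o f) by exact/measurable_EFinP.
have fE0 y : (0 <= (EFin \o f) y)%E by rewrite lee_fin.
under [RHS]eq_integral do rewrite EFinM.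
rewrite -(integral_rho_transition mg g0 mfE)//.
apply: ge0_ae_eq_integral => //.
- apply/measurable_EFinP/measurable_funM.
    exact: (measurableT_comp mg measurable_fst).
  exact: (measurableT_comp (measurable_markov_op rho_ mf) measurable_fst).
- apply: emeasurable_funM.
    by apply/measurable_EFinP; exact: (measurableT_comp mg measurable_fst).
  have mT := measurable_transition_integral rho_ mfE fE0.
  exact: (measurableT_comp mT measurable_fst).
- by move=> z _; rewrite lee_fin mulr_ge0// Rintegral_ge0.
- by move=> z _; rewrite mule_ge0 ?lee_fin// integral_ge0.
(* A [nu]-null set of $x$ pulls back to a [rho]-null set of pairs, off which [fine] loses
   nothing. *)
- have := ae_image measurable_fst rho_fst (ae_transition_integrable f2).
  apply: filterS => z iz _; rewrite EFinM /markov_op /Rintegral fineK//.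
  exact: integrable_fin_num.
Qed.

(** Extension from non-negative functions: first [f], then [g], is split into positive and negative
    parts. The $L^2$ bounds make every product [rho]-integrable, so the integrals may be
    subtracted. *)
Lemma markov_op_adjoint (g f : V -> R) :
  g \in Lfun nu 2%:E -> f \in Lfun nu 2%:E ->
  \int[rho]_z (g z.1 * markov_op rho_ f z.1) = \int[rho]_z (g z.1 * f z.2).
Proof.
have mul2 (p q : V -> R) (p2 : p \in Lfun nu 2%:E) (q2 : q \in Lfun nu 2%:E) :
    rho.-integrable setT (EFin \o (fun z => p z.1 * markov_op rho_ q z.1)) /\
    rho.-integrable setT (EFin \o (fun z => p z.1 * q z.2)).
  split; apply: Lfun2_integrableM; [exact: Lfun2_rho_fst| |
    exact: Lfun2_rho_fst|exact: Lfun2_rho_snd].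
  by apply: Lfun2_rho_fst; exact: markov_op_Lfun2.
have adj_g0 (p q : V -> R) : p \in Lfun nu 2%:E -> q \in Lfun nu 2%:E ->
    (forall x, 0 <= p x) ->
    \int[rho]_z (p z.1 * markov_op rho_ q z.1) = \int[rho]_z (p z.1 * q z.2).
  move=> p2 q2 p0.
  have qp2 := Lfun2_funrpos q2; have qn2 := Lfun2_funrneg q2.
  have [iPp ip] := mul2 _ _ p2 qp2; have [iPn inn] := mul2 _ _ p2 qn2.
  (* $Pq=Pq^+-Pq^-$ holds only where [q] is integrable for the transition measure, whence an
     almost-everywhere argument. *)
  transitivity (\int[rho]_z (p z.1 * markov_op rho_ q^\+ z.1
                             - p z.1 * markov_op rho_ q^\- z.1)).
    congr fine; apply: ae_eq_integral => //.
    - by have [/measurable_int] := mul2 _ _ p2 q2.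
    - exact: (measurable_int _ (integrableB measurableT iPp iPn)).
    - have := ae_image measurable_fst rho_fst (ae_transition_integrable q2).
      apply: filterS => z iz _; congr EFin; rewrite -mulrBr; congr *%R.
      rewrite /markov_op -RintegralB//.
      + by apply: eq_Rintegral => y _; rewrite -[in LHS](funrposBneg q).
      + exact: integrable_funrpos.
      + exact: integrable_funrneg.
  rewrite RintegralB// !ge0_markov_op_adjoint// -RintegralB//.
  by apply: eq_Rintegral => z _; rewrite -mulrBr -[in RHS](funrposBneg q).
move=> g2 f2.
have gp2 := Lfun2_funrpos g2; have gn2 := Lfun2_funrneg g2.
have [iPp ip] := mul2 _ _ gp2 f2; have [iPn inn] := mul2 _ _ gn2 f2.
have gE x : g x = g^\+ x - g^\- x by rewrite -[in LHS](funrposBneg g).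
under eq_Rintegral do rewrite gE mulrBl.
under [RHS]eq_Rintegral do rewrite gE mulrBl.
by rewrite RintegralB// [RHS]RintegralB// !adj_g0.
Qed.

Lemma markov_op_orthogonal (g f : V -> R) :
  g \in Lfun nu 2%:E -> f \in Lfun nu 2%:E ->
  \int[rho]_z (g z.1 * (markov_op rho_ f z.1 - f z.2)) = 0.
Proof.
move=> g2 f2; under eq_Rintegral do rewrite mulrBr.
rewrite RintegralB// ?markov_op_adjoint ?subrr//.
- apply: Lfun2_integrableM; apply: Lfun2_rho_fst => //.
  exact: markov_op_Lfun2.
- by apply: Lfun2_integrableM; [exact: Lfun2_rho_fst|exact: Lfun2_rho_snd].
Qed.

End stationary_chain.

(** * Two consecutive coordinates under the law of the chain started at a point *)

Lemma measure_setI_full d (T : measurableType d) (R : realType)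
  (Q : {measure set T -> \bar R}) (P S : set T) :
  measurable P -> measurable S -> Q P = 1%E -> Q setT = 1%E ->
  Q (S `&` P) = Q S.
Proof.
move=> mP mS QP QT; rewrite [RHS](measureDI _ mS mP).
have QD : Q (setT `\` P) = 0%E.
  rewrite measureD//; last by rewrite -[ltLHS]/(Q setT) QT ltry.
  by rewrite setTI -[LHS]/(Q setT - Q P)%E QT QP subee.
rewrite (@subset_measure0 _ _ _ Q (S `\` P) (setT `\` P)) ?add0e//.
- exact: measurableD.
- exact: measurableD.
- exact: setSD.
Qed.

Section path_law.
Context d (V : measurableType d) (R : realType) (rho_ : R.-ker V ~> V).
Local Open Scope ereal_scope.
Local Notation T f := (fun x => \int[transition rho_ x]_y f y).

(** Writes the event $X_n\in A,\ X_{n+1}\in B$ as a rectangle of the kind [markov_path_law]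
    evaluates. *)
Definition two_step_sets (n : nat) (A B : set V) (i : nat) : set V :=
  if i == n then A else if i == n.+1 then B else setT.

Lemma measurable_two_step_sets n A B i : measurable A -> measurable B ->
  measurable (two_step_sets n A B i).
Proof. by move=> mA mB; rewrite /two_step_sets; do 2 case: ifP => // _. Qed.

Lemma path_weight_two_step n A B x : measurable A -> measurable B ->
  path_weight rho_ n.+2 (two_step_sets n.+1 A B) x =
  iter n.+1 (fun f => T f) (fun y => (\1_A y)%:E * transition rho_ y B) x.
Proof.
move=> mA mB; elim: n x => [|n IHn] x.
  rewrite [LHS]/= /two_step_sets/= [LHS]integral_mkcond.
  apply: eq_integral => y _; rewrite patchE indicE (integral_cst _ mB) mul1e.
  by case: ifP => _; rewrite ?mul1e ?mul0e.
(* The set at time 1 is [setT], and shifting the indices by one turns [two_step_sets n.+2] into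
   [two_step_sets n.+1]. *)
rewrite -[LHS]/(\int[transition rho_ x]_y
  path_weight rho_ n.+2 (two_step_sets n.+1 A B) y).
by under eq_integral do rewrite IHn.
Qed.

Lemma path_law_two_step (Q : {measure set (path_space V) -> \bar R}) n A B x :
  measurable [set x] -> Q setT = 1 -> markov_path_law rho_ x Q ->
  measurable A -> measurable B ->
  Q (path_coord n @^-1` A `&` path_coord n.+1 @^-1` B) =
  iter n (fun f => T f) (fun y => (\1_A y)%:E * transition rho_ y B) x.
Proof.
move=> mx Q1 [Qx Qfd] mA mB.
have mcoord m C : measurable C -> measurable (@path_coord _ V m @^-1` C).
  by move=> mC; rewrite -[X in measurable X]setTI; exact: measurable_path_coord.
(* The prescribed distributions constrain only times from 1 on. Time 0 is handled through
   [paths_from x], of full mass, on which $X_0\in A$ just means $x\in A$. *)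
case: n => [|n].
  have mP : measurable (paths_from x) by exact: (mcoord 0%N _ mx).
  rewrite -(measure_setI_full mP _ Qx Q1); last first.
    by apply: measurableI; exact: mcoord.
  rewrite /= indicE; have [xA|xA] := boolP (x \in A); last first.
    rewrite mul0e [X in Q X](_ : _ = set0) ?measure0//.
    apply/seteqP; split => w //=.
    by move=> [[wA _] wx]; move: xA; rewrite notin_setE -wx.
  have BE : path_coord 1 @^-1` B =
      [set w : path_space V | forall i, (1 <= i <= 1)%N -> B (path_coord i w)].
    apply/seteqP; split => w /=.
      by move=> wB i; rewrite -eqn_leq => /eqP <-.
    move=> H; exact: (H 1%N isT).
  rewrite [X in Q X](_ : _ = path_coord 1 @^-1` B `&` paths_from x); last first.
    apply/seteqP; split => w /=; first by move=> [[_ wB] wx].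
    by move=> [wB wx]; split => //; split => //=; rewrite wx -in_setE.
  rewrite (measure_setI_full mP (mcoord _ _ mB) Qx Q1) BE.
  by rewrite (Qfd 1%N (fun=> B))//= (integral_cst _ mB) !mul1e.
rewrite -path_weight_two_step// -Qfd => [|i]; last first.
  exact: measurable_two_step_sets.
congr (Q _); apply/seteqP; split => w /=.
  move=> [wA wB] i _; rewrite /two_step_sets.
  by case: eqP => [->//|_]; case: eqP => [->|].
move=> wAB; have := wAB n.+1; have := wAB n.+2.
by rewrite /two_step_sets !eqxx !leqnn leqnSn gtn_eqF//= => /(_ isT) ? /(_ isT).
Qed.
End path_law.

(** * The law of consecutive coordinates under [lambda] *)

Section joint_law.
Context d (V : measurableType d) (R : realType).
Variables (mu : {sigma_finite_measure set V -> \bar R}).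
Variables (rho : {measure set (V * V) -> \bar R}) (rho_ : R.-ker V ~> V).
Variable PP : R.-pker V ~> path_space V.
Hypothesis rho_sym : forall A B : set V, measurable A -> measurable B ->
  rho (A `*` B) = rho (B `*` A).
Hypothesis rho_disintegration : forall f : V * V -> \bar R,
  measurable_fun setT f -> (forall z, (0 <= f z)%E) ->
  (\int[rho]_z f z = \int[mu]_x \int[rho_ x]_y f (x, y))%E.
Hypothesis c_pos_fin : {ae mu, forall x, (0 < ktotal rho_ x < +oo)%E}.
Hypothesis c_loc_integrable : forall A : set V, measurable A ->
  (mu A < +oo)%E -> (\int[mu]_(x in A) ktotal rho_ x < +oo)%E.
Hypothesis measurable_set1V : forall x : V, measurable [set x].
Hypothesis PP_law : {ae mu, forall x, markov_path_law rho_ x (PP x)}.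

Local Notation nu := (kweight mu rho_ : {measure set V -> \bar R}).
Local Notation lambda := (kmix nu PP : {measure set (path_space V) -> \bar R}).
Local Notation T f := (fun x => \int[transition rho_ x]_y f y)%E.

(** [nu] has a density with respect to [mu]. The path laws are known [mu]-almost everywhere, while
    [lambda] integrates them against [nu]. *)
Lemma ae_kweight (Q : V -> Prop) :
  {ae mu, forall x, Q x} -> {ae nu, forall x, Q x}.
Proof.
move=> [N [mN N0 QN]]; exists N; split => //.
apply: null_set_integral => //; apply: measurable_funTS.
exact: measurable_kernel.
Qed.

Definition step_pair (n : nat) (w : path_space V) : V * V :=
  (path_coord n w, path_coord n.+1 w).

Lemma measurable_step_pair n : measurable_fun setT (step_pair n).
Proof.
by apply/measurable_fun_pairP; split; exact: measurable_path_coord.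
Qed.

Lemma stationary_iter n (f : V -> \bar R) :
  measurable_fun setT f -> (forall x, 0 <= f x)%E ->
  [/\ measurable_fun setT (iter n (fun g => T g) f),
      forall x, (0 <= iter n (fun g => T g) f x)%E &
      (\int[nu]_x iter n (fun g => T g) f x = \int[nu]_x f x)%E].
Proof.
move=> mf f0; elim: n => [|n [mI I0 IE]]; first by split.
split; first exact: measurable_transition_integral.
  by move=> x; exact: transition_integral_ge0.
by rewrite -IE -(transition_stationary rho_sym rho_disintegration c_pos_fin mI).
Qed.

(** With $h(y)=1_A(y)P(y,B)$ the path law gives $\int T^nh\,d\nu$; stationarity removes $T^n$, and
    the disintegration turns $\int h\,d\nu$ into $\rho(A\times B)$. *)
Lemma joint_law_rectangle n A B : measurable A -> measurable B ->
  lambda (step_pair n @^-1` (A `*` B)) = rho (A `*` B).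
Proof.
move=> mA mB.
pose h y := ((\1_A y)%:E * transition rho_ y B)%E.
have mh : measurable_fun setT h.
  apply: emeasurable_funM; last exact: measurable_transition.
  by apply/measurable_EFinP; exact: measurable_indic.
have h0 y : (0 <= h y)%E by rewrite mule_ge0// lee_fin.
have [mI I0 IE] := stationary_iter n mh h0.
have mS : measurable (step_pair n @^-1` (A `*` B)).
  rewrite -[X in measurable X]setTI; apply: measurable_step_pair => //.
  exact: measurableX.
transitivity (\int[nu]_x iter n (fun g => T g) h x)%E.
  apply: ge0_ae_eq_integral => //; first exact: measurable_kernel.
  apply: filterS (ae_kweight PP_law) => x Px _.
  rewrite -(path_law_two_step n (measurable_set1V x) _ Px mA mB)//.
  exact: prob_kernel.
rewrite IE -(integral_nu_fst rho_disintegration mh h0).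
have mBE : measurable_fun setT (fun y => (\1_B y)%:E : \bar R).
  by apply/measurable_EFinP; exact: measurable_indic.
transitivity (\int[rho]_z ((\1_A z.1)%:E * T (fun y => (\1_B y)%:E) z.1))%E.
  by apply: eq_integral => z _; rewrite integral_indic// setIT.
rewrite (integral_rho_transition rho_disintegration c_pos_fin _ _ mBE)//.
rewrite -[X in rho X]setIT -integral_indic//; last exact: measurableX.
by apply: eq_integral => z _; rewrite -EFinM !indicE in_setX -natrM mulnb.
Qed.

(** Measures agreeing on the rectangles, a $\pi$-system generating the product $\sigma$-algebra, are
    equal once finite-measure rectangles exhaust the space. These are $F_k\times V$ with
    $\mu(F_k)<\infty$: their [rho]-measure is $\int_{F_k}c\,d\mu<\infty$. *)
Lemma joint_law n C : measurable C ->
  lambda (step_pair n @^-1` C) = rho C.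
Proof.
move=> mC.
have /sigma_finiteP[F [TF _ Foo]] := sigma_finiteT mu.
pose G : set (set (V * V)) :=
  [set C | exists A B, [/\ measurable A, measurable B & C = A `*` B]].
apply/esym; rewrite -[RHS]/(pushforward lambda (step_pair n) C).
apply: (measure_unique G (fun k => F k `*` setT)) => //.
- rewrite measurable_prod_measurableType//; congr (<<s _ >>).
  apply/seteqP; split => [_ [A mA [B mB <-]]|_ [A [B [mA mB ->]]]].
    by exists A, B.
  by exists A => //; exists B.
- move=> _ _ [A1 [B1 [mA1 mB1 ->]]] [A2 [B2 [mA2 mB2 ->]]].
  rewrite -setXI; exists (A1 `&` A2), (B1 `&` B2).
  by split => //; exact: measurableI.
- by move=> k; exists (F k), setT; split => //; have [] := Foo k.
- apply/seteqP; split => // -[x y] _.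
  by have [k _ Fkx] : (\bigcup_i F i) x; [rewrite -TF|exists k].
- exact: measurable_step_pair.
- by move=> mphi _ [A [B [mA mB ->]]]; exact/esym/joint_law_rectangle.
- move=> k; have [mF Fk] := Foo k.
  rewrite (_ : _ `*` _ = fst @^-1` F k).
    by rewrite (rho_fst rho_disintegration mF) c_loc_integrable.
  by apply/seteqP; split => z // -[].
Qed.

End joint_law.

(** * Orthogonality in the dissipation space *)

Theorem theorem5p6 (R : realType) (d : measure_display) (V : measurableType d)
    (V_standard : standard_borel R V)
    (V_uncountable : ~ countable [set: V])
    (mu : {sigma_finite_measure set V -> \bar R})
    (mu_non_atomic : non_atomic mu)
    (rho : {sigma_finite_measure set (V * V)%type -> \bar R})
    (rho_sym : forall A B : set V, measurable A -> measurable B ->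
       rho (A `*` B) = rho (B `*` A))
    (rho_ : R.-ker V ~> V)
    (rho_disintegration : forall f : V * V -> \bar R,
       measurable_fun setT f -> (forall z, (0 <= f z)%E) ->
       (\int[rho]_z f z = \int[mu]_x \int[rho_ x]_y f (x, y))%E)
    (c_pos_fin : {ae mu, forall x, (0 < ktotal rho_ x < +oo)%E})
    (c_loc_integrable : forall A : set V, measurable A -> (mu A < +oo)%E ->
       (\int[mu]_(x in A) ktotal rho_ x < +oo)%E)
    (PP : R.-pker V ~> path_space V)
    (PP_law : {ae mu, forall x, markov_path_law rho_ x (PP x)}) :
  let nu : {measure set V -> \bar R} := kweight mu rho_ in
  let P : (V -> R) -> (V -> R) := markov_op rho_ in
  let lambda : {measure set (path_space V) -> \bar R} := kmix nu PP in
  (forall g1 g2 : V -> R, g1 \in Lfun nu 2%:E -> g2 \in Lfun nu 2%:E ->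
     forall n : nat,
       let u := fun w => g1 (path_coord n w) in
       let v := fun w => P g2 (path_coord n w) - g2 (path_coord n.+1 w) in
       [/\ in_diss lambda u, in_diss lambda v & diss_inner lambda u v = 0])
  /\
  (forall f : V -> R, f \in Lfun nu 2%:E ->
     forall n : nat,
       diss_orthogonal lambda
         (fun w => f (path_coord n w) - P f (path_coord n w))
         (fun w => P f (path_coord n w) - f (path_coord n.+1 w))).
Proof.
move=> nu P lambda.
have V_set1 x := standard_borel_measurable_set1 x V_standard.
have law n C : measurable C -> lambda (step_pair n @^-1` C) = rho C.
  exact: (joint_law rho_sym rho_disintegration c_pos_fin c_loc_integrable).
have rho1 := rho_fst rho_disintegration.
have rho2 := rho_snd rho_sym rho_disintegration.
have P2 := markov_op_Lfun2 rho_sym rho_disintegration c_pos_fin.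
have diss n (F : V * V -> R) : F \in Lfun rho 2%:E ->
    in_diss lambda (F \o step_pair n).
  exact: (Lfun2_image (measurable_step_pair n) (law n)).
have v2 f : f \in Lfun nu 2%:E -> (fun z => P f z.1 - f z.2) \in Lfun rho 2%:E.
  move=> f2; apply: Lfun2B; last exact: (Lfun2_image measurable_snd rho2 f2).
  exact: (Lfun2_image measurable_fst rho1 (P2 _ f2)).
(* Both functions factor through [step_pair n], so the inner product is half an integral against
   [rho], whatever [n] is. *)
have orth g f n : g \in Lfun nu 2%:E -> f \in Lfun nu 2%:E ->
    diss_orthogonal lambda (fun w => g (path_coord n w))
      (fun w => P f (path_coord n w) - f (path_coord n.+1 w)).
  move=> g2 f2; have gr2 := Lfun2_image measurable_fst rho1 g2.
  split; [exact: diss gr2|exact: diss (v2 _ f2)|].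
  have gv := Lfun2_integrableM gr2 (v2 _ f2).
  rewrite /diss_inner (Rintegral_image (measurable_step_pair n) (law n) gv).
  by rewrite (markov_op_orthogonal rho_sym rho_disintegration)// mulr0.
split=> [g1 g2 /orth g1o g2L2 n u v|f f2 n]; first exact: g1o.
(* The second claim is the first with $g=f-Pf$, which lies in $L^2(\nu)$ because [P] preserves that
   space. *)
by apply: (orth (fun x => f x - P f x)) => //; exact/Lfun2B/P2.
Qed.
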